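(* Let $\mathcal{X}\subseteq\mathbb{R}^n$, $\mathcal{U}\subseteq\mathbb{R}^p$, and $F:\mathcal{X}\times\mathcal{U}\to\mathcal{X}$. Let $N_x\ge n$, let $g_{n+1},\dots,g_{N_x}:\mathcal{X}\to\mathbb{R}$ be functions, and let $\mathbf{A}\in\mathbb{R}^{N_x\times N_x}$, $\mathbf{B}\in\mathbb{R}^{N_x\times p}$. For arbitrary $\chi\in\mathcal{X}$ and $u\in\mathcal{U}$, the following is a necessary condition for $\mathcal{E}(\chi,u)=0$ to hold: $$\mathbf{A}\begin{bmatrix}\chi\\ g_{n+1}(\chi)\\ \vdots\\ g_{N_x}(\chi)\end{bmatrix}+\mathbf{B}u\in\mathcal{M},$$ where $$\mathcal{M}:=\left\{v=[v_1\ \cdots\ v_{N_x}]^{\mathsf T}\in\mathbb{R}^{N_x}\ \middle|\ \exists\,\chi'\in\mathcal{X}:\ [v_1\ \cdots\ v_n]^{\mathsf T}=\chi',\ v_i=g_i(\chi')\ (i=n+1,\dots,N_x)\right\}.$$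
   Context: The dynamics is the discrete-time system $\chi^+=F(\chi,u)$. The linear embedding model given by the feature maps $g_i$ and the matrices $\mathbf{A},\mathbf{B}$ approximates $[(\chi^+)^{\mathsf T}\ g_{n+1}(\chi^+)\ \cdots\ g_{N_x}(\chi^+)]^{\mathsf T}$ by $\mathbf{A}[\chi^{\mathsf T}\ g_{n+1}(\chi)\ \cdots\ g_{N_x}(\chi)]^{\mathsf T}+\mathbf{B}u$. The modeling error at $(\chi,u)\in\mathcal{X}\times\mathcal{U}$ is $$\mathcal{E}(\chi,u):=\left\|\begin{bmatrix}\chi^+\\ g_{n+1}(\chi^+)\\ \vdots\\ g_{N_x}(\chi^+)\end{bmatrix}-\left(\mathbf{A}\begin{bmatrix}\chi\\ g_{n+1}(\chi)\\ \vdots\\ g_{N_x}(\chi)\end{bmatrix}+\mathbf{B}u\right)\right\|_2,\qquad \chi^+=F(\chi,u),$$ where $\|\cdot\|_2$ is the Euclidean norm. *)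

(* Defs.v *)
From HB Require Import structures.
From mathcomp Require Import all_boot all_order all_algebra.
From mathcomp Require Import classical_sets reals.

Set Implicit Arguments.
Unset Strict Implicit.
Unset Printing Implicit Defensive.

Import Order.TTheory GRing.Theory Num.Theory.
Local Open Scope classical_set_scope.
Local Open Scope ring_scope.

(* A set [X : set T] used as a type is the subtype of its elements, so a
   function with domain [X] is defined on [X] only; [val] is the inclusion.
   The lifted dimension N_x >= n is written [n + m], i.e. m = N_x - n, and the
   feature map [g i], for [i : 'I_m] (counted from 0), is g_{n+1+i}. *)

(* MathComp-Analysis norms matrices with the sup norm, hence this definition. *)
Definition l2norm (R : realType) (k : nat) (v : 'cV[R]_k) : R :=
  Num.sqrt (\sum_(i < k) v i 0 ^+ 2).

Definition lifted_state (R : realType) (n m : nat) (X : set 'cV[R]_n)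
    (g : 'I_m -> X -> R) (chi : X) : 'cV[R]_(n + m) :=
  col_mx (val chi) (\col_(i < m) g i chi).

Definition model_prediction (R : realType) (n m p : nat)
    (X : set 'cV[R]_n) (U : set 'cV[R]_p) (g : 'I_m -> X -> R)
    (A : 'M[R]_(n + m)) (B : 'M[R]_(n + m, p)) (chi : X) (u : U) :
    'cV[R]_(n + m) :=
  A *m lifted_state g chi + B *m val u.

Definition modeling_error (R : realType) (n m p : nat)
    (X : set 'cV[R]_n) (U : set 'cV[R]_p) (F : X * U -> X)
    (g : 'I_m -> X -> R) (A : 'M[R]_(n + m)) (B : 'M[R]_(n + m, p))
    (chi : X) (u : U) : R :=
  l2norm (lifted_state g (F (chi, u)) - model_prediction g A B chi u).

Definition lifted_set (R : realType) (n m : nat) (X : set 'cV[R]_n)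
    (g : 'I_m -> X -> R) : set 'cV[R]_(n + m) :=
  [set v | exists chi' : X,
     usubmx v = val chi' /\ forall i : 'I_m, v (rshift n i) 0 = g i chi'].

(* Main.v *)
Require Import Defs.
From mathcomp Require Import all_boot all_order all_algebra.
From mathcomp Require Import classical_sets reals.

(** The norm separates points, so a vanishing modeling error forces the
    prediction to equal the lift of the true successor state
    [F (chi, u)]. As [F] takes its values in [X], that lift lies in
    [lifted_set g], with the successor state itself as the witness. *)

Import Order.TTheory GRing.Theory Num.Theory.
Local Open Scope classical_set_scope.
Local Open Scope ring_scope.

(** A sum of squares vanishes only if each square does. *)
Lemma l2norm_eq0 (R : realType) (k : nat) (v : 'cV[R]_k) :
  l2norm v = 0 -> v = 0.
Proof.
have sq_ge0 (i : 'I_k) : true -> 0 <= v i 0 ^+ 2 by rewrite sqr_ge0.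
move=> /eqP; rewrite sqrtr_eq0 => sum_le0.
have /eqP : \sum_(i < k) v i 0 ^+ 2 == 0.
  by rewrite eq_le sum_le0 sumr_ge0.
move=> /(psumr_eq0P sq_ge0) sq0.
apply/colP => i; rewrite mxE.
by apply/eqP; rewrite -sqrf_eq0 sq0.
Qed.

Lemma lifted_state_in_lifted_set (R : realType) (n m : nat)
    (X : set 'cV[R]_n) (g : 'I_m -> X -> R) (chi : X) :
  lifted_state g chi \in lifted_set g.
Proof.
rewrite inE; exists chi; split; first by rewrite col_mxKu.
by move=> i; rewrite col_mxEd mxE.
Qed.

Theorem proposition2 (R : realType) (n m p : nat)
    (X : set 'cV[R]_n) (U : set 'cV[R]_p) (F : X * U -> X)
    (g : 'I_m -> X -> R) (A : 'M[R]_(n + m)) (B : 'M[R]_(n + m, p))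
    (chi : X) (u : U) :
  modeling_error F g A B chi u = 0 ->
  A *m lifted_state g chi + B *m val u \in lifted_set g.
Proof.
move=> /l2norm_eq0/subr0_eq; rewrite /model_prediction => <-.
exact: lifted_state_in_lifted_set.
Qed.
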